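(* Let $E_8$ also denote the orthogonality graph of the root system $E_8$: its vertices are the $120$ lines (rays up to sign) in $\mathbb{R}^8$ spanned by the vectors in $$\{e_i\pm e_j:1\le i<j\le 8\}\ \cup\ \Big\{(x_1,\dots,x_8): x_i=\pm1,\ \prod_{i=1}^8x_i=1\Big\},$$ where $e_1,\dots,e_8$ is the standard basis, and two vertices are adjacent if and only if the corresponding lines are orthogonal. Then $$C_0(E_8)\le\log 9\qquad\text{while}\qquad C_0^{\mathrm{E}}(E_8)=\log 15 .$$
   Context: Channels. A (discrete memoryless) classical channel $\mathcal{N}$ has finite input alphabet $X$, finite output alphabet $Y$, and conditional probabilities $\mathcal{N}(y|x)$. $\mathcal{N}^{\otimes n}$ denotes $n$ independent uses of $\mathcal{N}$. Confusability graph. Distinct inputs $x_1,x_2$ are confusable if some $y$ has $\mathcal{N}(y|x_1)>0$ and $\mathcal{N}(y|x_2)>0$. The confusability graph $G(\mathcal{N})$ is the simple graph on $X$ whose edges are the confusable pairs. Unassisted zero-error capacity. $M_0(\mathcal{N})$ is the maximum number of messages that can be sent with a single use of $\mathcal{N}$ with zero probability of decoding error; it equals the independence number $\alpha(G(\mathcal{N}))$. $C_0(\mathcal{N}):=\lim_{n\to\infty}\frac1n\log M_0(\mathcal{N}^{\otimes n})$. Equivalently, for a graph $G$, $C_0(G)=\log\Theta(G)$ with $\Theta(G)=\lim_{n}\sqrt[n]{\alpha(G^{\boxtimes n})}$. Here $G^{\boxtimes n}$ is the strong power: its vertices are $V(G)^n$, and distinct $n$-tuples $a,b$ are adjacent if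 and only if for each $j$ either $a_j=b_j$ or $a_jb_j\in E(G)$. Entanglement-assisted zero-error capacity. $M_0^{\mathrm{E}}(\mathcal{N})$ is the largest integer $q$ for which the following exist: finite-dimensional complex Hilbert spaces $H_A,H_B$; a density operator $\rho$ on $H_A\otimes H_B$; for each message $m\in\{1,\dots,q\}$ a POVM $\{A^{m}_x\}_{x\in X}$ on $H_A$; and for each $y\in Y$ a POVM $\{B^{y}_{m'}\}_{m'=1}^q$ on $H_B$; such that $\sum_{x,y}\mathcal{N}(y|x)\operatorname{Tr}[\rho\,(A^m_x\otimes B^y_{m'})]=0$ whenever $m\neq m'$. $C_0^{\mathrm{E}}(\mathcal{N}):=\lim_{n\to\infty}\frac1n\log M_0^{\mathrm{E}}(\mathcal{N}^{\otimes n})$. All these quantities depend only on the confusability graph of the channel. For a graph $G$, $C_0(G)$ and $C_0^{\mathrm{E}}(G)$ denote the values for any channel whose confusability graph is $G$. Logarithms are to an arbitrary fixed base. *)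

(* Defs.v *)
From HB Require Import structures.
From mathcomp Require Import all_boot all_order all_algebra.
From mathcomp Require Import all_classical all_reals all_analysis.
From mathcomp Require Import complex mxtens.

Set Implicit Arguments.
Unset Strict Implicit.
Unset Printing Implicit Defensive.

Import Order.TTheory GRing.Theory Num.Theory.
Import numFieldNormedType.Exports.

Local Open Scope classical_set_scope.
Local Open Scope ring_scope.
Local Open Scope complex_scope.
Local Open Scope sesquilinear_scope.

(* Largest element of a set of integers; the value is 0 when there is none. *)
Definition largest (A : set nat) : nat := xget 0%N (A `&` ubound A).

Definition log (R : realType) (b x : R) : R := ln x / ln b.

(* [N x y] is the conditional probability N(y|x). *)
Record channel (R : realType) (X Y : finType) := Channel {
  prob :> X -> Y -> R;
  prob_ge0 : forall x y, 0 <= prob x y;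
  prob_sum1 : forall x, \sum_y prob x y = 1 }.

Section ChannelPower.
Variables (R : realType) (X Y : finType) (N : channel R X Y) (n : nat).

Definition power_prob (x : {ffun 'I_n -> X}) (y : {ffun 'I_n -> Y}) : R :=
  \prod_(i < n) N (x i) (y i).

Lemma power_prob_ge0 x y : 0 <= power_prob x y.
Proof. by apply: prodr_ge0 => i _; apply: prob_ge0. Qed.

Lemma power_prob_sum1 x : \sum_y power_prob x y = 1.
Proof.
rewrite /power_prob -(bigA_distr_bigA (fun i y => N (x i) y)) /=.
by apply: big1 => i _; apply: prob_sum1.
Qed.

Definition channel_power :
    channel R {ffun 'I_n -> X} {ffun 'I_n -> Y} :=
  Channel power_prob_ge0 power_prob_sum1.

End ChannelPower.

Section Capacities.
Variables (R : realType).

Definition confusable (X Y : finType) (N : channel R X Y) (x1 x2 : X) : Prop :=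
  x1 <> x2 /\ exists y, 0 < N x1 y /\ 0 < N x2 y.

(* The confusability graph of [N] is, up to an isomorphism, the graph with
   vertex set [V] and adjacency relation [adj]. *)
Definition has_confusability_graph (X Y : finType) (N : channel R X Y)
    (T : Type) (V : set T) (adj : T -> T -> Prop) : Prop :=
  exists2 f : X -> T, set_bij [set: X] V f &
    forall x1 x2, confusable N x1 x2 <-> adj (f x1) (f x2).

Definition zero_error_code (X Y : finType) (N : channel R X Y) (q : nat) :
    Prop :=
  exists (enc : 'I_q -> X) (dec : Y -> 'I_q),
    forall m, \sum_(y | dec y != m) N (enc m) y = 0.

Definition M0 (X Y : finType) (N : channel R X Y) : nat :=
  largest [set q | zero_error_code N q].

Definition C0_rate (b : R) (X Y : finType) (N : channel R X Y) : R^nat :=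
  fun n => n%:R^-1 * log b (M0 (channel_power N n))%:R.

Definition C0 (b : R) (X Y : finType) (N : channel R X Y) : R :=
  limn (C0_rate b N).

(* The order on [R[i]] makes [0 <= z] mean that z is real and nonnegative. *)
Definition positive_op (d : nat) (A : 'M[R[i]]_d) : Prop :=
  forall v : 'cV[R[i]]_d, 0 <= (v ^t* *m A *m v) 0 0.

Definition density_op (d : nat) (rho : 'M[R[i]]_d) : Prop :=
  positive_op rho /\ \tr rho = 1.

Definition povm (d : nat) (I : finType) (E : I -> 'M[R[i]]_d) : Prop :=
  (forall i, positive_op (E i)) /\ \sum_i E i = 1%:M.

(* The Hilbert spaces are C^dA and C^dB, with C^dA (x) C^dB identified with
   C^(dA * dB) through the Kronecker product [*t]. *)
Definition entangled_zero_error_code (X Y : finType) (N : channel R X Y)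
    (q : nat) : Prop :=
  exists (dA dB : nat) (rho : 'M[R[i]]_(dA * dB))
         (A : 'I_q -> X -> 'M[R[i]]_dA) (B : Y -> 'I_q -> 'M[R[i]]_dB),
    [/\ density_op rho,
        forall m, povm (A m),
        forall y, povm (B y) &
        forall m m', m != m' ->
          \sum_x \sum_y (N x y)%:C * \tr (rho *m (A m x *t B y m')) = 0].

Definition M0E (X Y : finType) (N : channel R X Y) : nat :=
  largest [set q | entangled_zero_error_code N q].

Definition C0E_rate (b : R) (X Y : finType) (N : channel R X Y) : R^nat :=
  fun n => n%:R^-1 * log b (M0E (channel_power N n))%:R.

Definition C0E (b : R) (X Y : finType) (N : channel R X Y) : R :=
  limn (C0E_rate b N).

End Capacities.

Section E8.
Variable R : realType.

Definition basis_vector (i : 'I_8) : 'rV[R]_8 := delta_mx 0 i.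

Definition E8_vectors : set 'rV[R]_8 :=
  [set v : 'rV[R]_8 | exists i j : 'I_8, (i < j)%N /\
     (v = basis_vector i + basis_vector j \/
      v = basis_vector i - basis_vector j)]
  `|` [set v : 'rV[R]_8 | (forall i, v 0 i = 1 \/ v 0 i = -1) /\
                        \prod_i v 0 i = 1].

Definition E8_lines : set {vspace 'rV[R]_8} :=
  [set <[v]>%VS | v in E8_vectors].

Definition orthogonal_lines (L1 L2 : {vspace 'rV[R]_8}) : Prop :=
  forall u v, u \in L1 -> v \in L2 -> u *m v^T = 0.

End E8.

Arguments E8_vectors : clear implicits.
Arguments E8_lines : clear implicits.

(* Main.v *)
(** Entangled capacity. The 120 lines split into 15 orthogonal frames of 8. These
frames are cliques covering the confusability graph, and each clique contributes
at most one entanglement-assisted message: for a clique [c], the states of Bob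
left by Alice's outcomes in [c] are orthogonal for different messages [m], so
the projectors [P m c] on their supports satisfy [\sum_m P m c <= 1], while
[\sum_m \sum_c tr (rho (1 (x) P m c))] is at least the number of messages.
Conversely, with a maximally entangled state Alice measures in the frame indexed
by her message and sends the outcome; Bob distinguishes the pairwise orthogonal
vectors compatible with what he receives. Both arguments tensorize.

Unassisted capacity. With the roots of norm 2, the matrix
[1 + <v, w> mod 2] over F_2 has rank at most 9, is 1 on the diagonal and vanishes
on non-orthogonal pairs of distinct lines, so Haemers' bound gives [9 ^ n].
Convergence of the rates is Fekete's lemma. *)
Require Import Defs.
From mathcomp Require Import all_boot all_order all_algebra.
From mathcomp Require Import all_classical all_reals all_analysis.
From mathcomp Require Import complex mxtens ring lra.
Import Order.TTheory GRing.Theory Num.Theory.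
Import numFieldNormedType.Exports.
Local Open Scope classical_set_scope.
Local Open Scope ring_scope.
Local Open Scope sesquilinear_scope.

Set Implicit Arguments.
Unset Strict Implicit.
Unset Printing Implicit Defensive.

(** * Positive semidefinite complex matrices and their Gram factorizations *)

Section PositiveMatrices.
Variable C : numClosedFieldType.

Lemma adjmxM m n p (A : 'M[C]_(m, n)) (B : 'M[C]_(n, p)) :
  (A *m B)^t* = B^t* *m A^t*.
Proof. by rewrite trmx_mul map_mxM. Qed.

Lemma adjmxD m n (A B : 'M[C]_(m, n)) : (A + B)^t* = A^t* + B^t*.
Proof. by rewrite linearD map_mxD. Qed.

Lemma adjmxB m n (A B : 'M[C]_(m, n)) : (A - B)^t* = A^t* - B^t*.
Proof. by rewrite linearB map_mxB. Qed.

Lemma adjmx_delta n (i : 'I_n) :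
  (delta_mx i 0 : 'cV[C]_n)^t* = delta_mx 0 i.
Proof. by rewrite trmx_delta map_delta_mx. Qed.

Lemma adjmx_scale m n (c : C) (A : 'M[C]_(m, n)) : (c *: A)^t* = c^* *: A^t*.
Proof. by rewrite linearZ map_mxZ. Qed.

Lemma adjmx_tens m n p q (A : 'M[C]_(m, n)) (B : 'M[C]_(p, q)) :
  (A *t B)^t* = A^t* *t B^t*.
Proof. by rewrite trmx_tens map_mxT. Qed.

Lemma quadratic_form_delta n (D : 'M[C]_n) i j :
  (delta_mx 0 i *m D *m delta_mx j 0 : 'M[C]_1) 0 0 = D i j.
Proof. by rewrite -rowE -colE !mxE. Qed.

(** Polarization: at [e_i + c e_j], the choice [c = 0] kills the diagonal, [c = 1] gives
    [D i j + D j i = 0], and [c = 'i] gives [D i j = D j i]. *)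
Lemma quadratic_form_eq0 n (D : 'M[C]_n) :
  (forall v : 'cV[C]_n, (v^t* *m D *m v) 0 0 = 0) -> D = 0.
Proof.
move=> D0.
have mx11D (A B : 'M[C]_1) : (A + B) 0 0 = A 0 0 + B 0 0 by rewrite mxE.
have mx11Z c (A : 'M[C]_1) : (c *: A) 0 0 = c * A 0 0 by rewrite mxE.
have polar c i j :
  (c^* * c) * D j j + D i i + c * D i j + c^* * D j i = 0.
  have := D0 (delta_mx i 0 + c *: delta_mx j 0).
  rewrite adjmxD adjmx_scale !adjmx_delta !mulmxDl !mulmxDr -!scalemxAl.
  rewrite -?scalemxAr -?scalemxAl -?scalemxAr.
  rewrite !(mx11D, mx11Z) !quadratic_form_delta => <-.
  ring.
have diag i : D i i = 0.
  by have := polar 0 i i; rewrite rmorph0 !mul0r !addr0 add0r.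
apply/matrixP => i j; rewrite !mxE.
have := polar 1 i j; have := polar 'i i j.
rewrite !diag !mulr0 !add0r rmorph1 !mul1r conjCi mulNr -mulrBr => /eqP.
rewrite mulf_eq0 (negPf (neq0Ci C)) /= subr_eq0 => /eqP -> /eqP.
by rewrite -mulr2n mulrn_eq0 /= => /eqP.
Qed.

(** The form of [A^t*] takes conjugate values to that of [A], and nonnegative numbers are real, so
    [A^t* - A] has zero quadratic form. *)
Lemma adjmx_psd n (A : 'M[C]_n) :
  (forall v : 'cV[C]_n, 0 <= (v^t* *m A *m v) 0 0) -> A^t* = A.
Proof.
move=> A_ge0; apply/eqP; rewrite -subr_eq0; apply/eqP.
have mx11B (M N : 'M[C]_1) : (M - N) 0 0 = M 0 0 - N 0 0 by rewrite !mxE.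
apply: quadratic_form_eq0 => v; rewrite mulmxBr mulmxBl mx11B.
have -> : v^t* *m A^t* *m v = (v^t* *m A *m v)^t*.
  by rewrite !adjmxM trmxCK mulmxA.
by rewrite [(_^t*) 0 0]mxE [X in X^*]mxE (CrealP (ger0_real (A_ge0 v))) subrr.
Qed.

(** Spectral theorem: diagonalize by a unitary and take square roots of the eigenvalues. *)
Lemma psd_factor n (A : 'M[C]_n) :
  (forall v : 'cV[C]_n, 0 <= (v^t* *m A *m v) 0 0) ->
  exists K : 'M[C]_n, A = K^t* *m K.
Proof.
move=> A_ge0; have adjA := adjmx_psd A_ge0.
have /orthomx_spectralP AE : A \is normalmx by apply/normalmxP; rewrite adjA.
set P := spectralmx A in AE; set d := spectral_diag A in AE.
have Pu : P \is unitarymx := spectral_unitarymx A.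
have dE : diag_mx d = P *m A *m P^t*.
  rewrite AE invmx_unitary // !mulmxA (unitarymxP Pu) mul1mx.
  by rewrite -mulmxA (unitarymxP Pu) mulmx1.
(* An eigenvalue is the value of the form at the adjoint of a row of [P]. *)
have d_ge0 i : 0 <= d 0 i.
  have := A_ge0 ((row i P)^t*); rewrite trmxCK.
  suff -> : row i P *m A *m (row i P)^t* = (row i (diag_mx d)) *m delta_mx i 0.
    by rewrite -colE !mxE eqxx.
  by rewrite dE !row_mul -[RHS]mulmxA -colE tr_row map_col.
exists (diag_mx (map_mx sqrtC d) *m P).
rewrite adjmxM AE invmx_unitary // -!mulmxA; congr (_ *m _).
rewrite mulmxA; congr (_ *m _); apply/matrixP => i j.
rewrite tr_diag_mx map_diag_mx mulmx_diag !mxE.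
have [->|] := eqVneq i j; last by rewrite !mulr0n.
rewrite !mulr1n /=.
by rewrite geC0_conj ?sqrtC_ge0 // -expr2 sqrtCK.
Qed.

Lemma mxtrace_adjE m n (M : 'M[C]_(m, n)) :
  \tr (M^t* *m M) = \sum_j \sum_i `|M i j| ^+ 2.
Proof.
apply: eq_bigr => j _; rewrite mxE; apply: eq_bigr => i _.
by rewrite !mxE normCK mulrC.
Qed.

Lemma mxtrace_adj_ge0 m n (M : 'M[C]_(m, n)) : 0 <= \tr (M^t* *m M).
Proof.
by rewrite mxtrace_adjE; do 2!apply: sumr_ge0 => ? _; rewrite exprn_ge0.
Qed.

Lemma mxtrace_adj_eq0 m n (M : 'M[C]_(m, n)) : \tr (M^t* *m M) = 0 -> M = 0.
Proof.
rewrite mxtrace_adjE => M0; apply/matrixP => i j; rewrite mxE; apply/eqP.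
have ge0 k l : 0 <= `|M k l| ^+ 2 by rewrite exprn_ge0.
have sum_ge0 l : true -> 0 <= \sum_k `|M k l| ^+ 2 by move=> _; apply: sumr_ge0.
have colj := @psumr_eq0P _ _ _ _ sum_ge0 M0 j isT.
have /eqP := @psumr_eq0P _ _ _ _ (fun k _ => ge0 k j) colj i isT.
by rewrite sqrf_eq0 normr_eq0 => /eqP ->.
Qed.

Lemma orthonormal_row_basis m n (U : 'M[C]_(m, n)) :
  exists2 Q : 'M[C]_(\rank U, n), Q *m Q^t* = 1%:M & (Q :=: U)%MS.
Proof.
have le_rank : (\rank U <= n)%N := rank_leq_col U.
exists (schmidt (row_base U)); first exact/unitarymxP/schmidt_unitarymx.
by apply: eqmx_trans (eq_row_base U); apply: eqmx_schmidt_free; rewrite row_base_free.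
Qed.

End PositiveMatrices.

(** * Kronecker products *)

Lemma sum_mxtens (V : nmodType) m n (F : 'I_(m * n) -> V) :
  \sum_k F k = \sum_i \sum_j F (mxtens_index (i, j)).
Proof.
rewrite pair_big; apply: (reindex (fun p => mxtens_index (p.1, p.2))).
exists (@mxtens_unindex m n) => [[i j]|k] _ /=; first exact: mxtens_indexK.
exact: mxtens_unindexK.
Qed.

Section TensorProduct.
Variable R : comPzRingType.

Lemma tensmx_suml (I : finType) m n p q (A : I -> 'M[R]_(m, n)) (B : 'M[R]_(p, q)) :
  (\sum_i A i) *t B = \sum_i A i *t B.
Proof.
apply/matrixP => k l; rewrite summxE mxE summxE mulr_suml.
by apply: eq_bigr => i _; rewrite mxE.
Qed.

Lemma tensmx_sumr (I : finType) m n p q (A : 'M[R]_(m, n)) (B : I -> 'M[R]_(p, q)) :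
  A *t (\sum_i B i) = \sum_i A *t B i.
Proof.
apply/matrixP => k l; rewrite summxE mxE summxE mulr_sumr.
by apply: eq_bigr => i _; rewrite mxE.
Qed.

Lemma tensmx_subr m n p q (A : 'M[R]_(m, n)) (B B' : 'M[R]_(p, q)) :
  A *t (B - B') = A *t B - A *t B'.
Proof. by apply/matrixP => k l; rewrite !mxE mulrBr. Qed.

Lemma tensmx11 m n : 1%:M *t 1%:M = 1%:M :> 'M[R]_(m * n).
Proof.
apply/matrixP => k l; case: (mxtens_indexP k) => i j.
case: (mxtens_indexP l) => i' j'; rewrite tensmxE !mxE -natrM mulnb -xpair_eqE.
by rewrite (can_eq (@mxtens_indexK m n)).
Qed.

(* The matrix whose columns are the components in the second tensor factor of
   the columns of [W]. *)
Definition second_factor m n r (W : 'M[R]_(m * n, r)) : 'M[R]_(n, m * r) :=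
  \matrix_(j, k) W (mxtens_index ((mxtens_unindex k).1, j)) (mxtens_unindex k).2.

Lemma second_factor_inj m n r : injective (@second_factor m n r).
Proof.
move=> W W' /matrixP eqW; apply/matrixP => k l.
case: (mxtens_indexP k) => i j.
by have := eqW j (mxtens_index (i, l)); rewrite !mxE mxtens_indexK.
Qed.

(** Bob's local operators become plain left multiplications, so statements about [1 (x) P] reduce to
    matrix products in his space alone. *)
Lemma second_factor_tens m n p r (P : 'M[R]_(p, n)) (W : 'M[R]_(m * n, r)) :
  second_factor ((1%:M *t P) *m W) = P *m second_factor W.
Proof.
apply/matrixP => j k; rewrite !mxE sum_mxtens exchange_big /=.
apply: eq_bigr => j' _; rewrite !mxE (bigD1 (mxtens_unindex k).1) //= big1.
  by rewrite addr0 tensmxE mxE eqxx mul1r.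
by move=> i /negPf ne; rewrite tensmxE mxE eq_sym ne !mul0r.
Qed.

End TensorProduct.

(** * Clique covers bound entanglement-assisted codes *)

Section CliqueBound.
Variable C : numClosedFieldType.

(** With [Q] an orthonormal basis of the row space of [U], take [P = Q^t* *m Q]. The equation
    [P = P^t* *m P] encodes both self-adjointness and idempotence. *)
Lemma orthogonal_projector m n (U : 'M[C]_(m, n)) :
  exists P : 'M[C]_n, [/\ P = P^t* *m P, U *m P = U &
    forall k (V : 'M[C]_(k, n)), U *m V^t* = 0 -> P *m V^t* = 0].
Proof.
have [Q Q1 QU] := orthonormal_row_basis U; exists (Q^t* *m Q).
have adjP : (Q^t* *m Q)^t* = Q^t* *m Q by rewrite adjmxM trmxCK.
split=> [||k V UV0].
- by rewrite adjP -mulmxA [Q *m (_ *m _)]mulmxA Q1 mul1mx.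
- have /submxP[D UE] : (U <= Q)%MS by rewrite QU.
  by rewrite {1}UE -mulmxA [Q *m (_ *m _)]mulmxA Q1 mul1mx -UE.
- have /submxP[D QE] : (Q <= U)%MS by rewrite QU.
  by rewrite -mulmxA {2}QE -!mulmxA UV0 !mulmx0.
Qed.

Lemma mxtrace_rotate n r (L : 'M[C]_(n, r)) (L' : 'M[C]_(r, n)) (P Q S : 'M[C]_n) :
  \tr (L *m L' *m (P *m (Q *m S))) = \tr (L' *m (P *m (Q *m (S *m L)))).
Proof. by rewrite -mulmxA mxtrace_mulC !mulmxA. Qed.

(** A joint outcome probability is a squared Frobenius norm: it is nonnegative, and it vanishes only
    if the matrix under the norm does. *)
Lemma tr_tens_gram a a' b b' r (K : 'M[C]_(a', a)) (J : 'M[C]_(b', b))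
    (L : 'M[C]_(a * b, r)) :
  \tr (L *m L^t* *m ((K^t* *m K) *t (J^t* *m J))) =
  \tr (((K *t J) *m L)^t* *m ((K *t J) *m L)).
Proof.
rewrite -mulmxA mxtrace_mulC adjmxM adjmx_tens -tensmx_mul.
by rewrite !mulmxA.
Qed.

End CliqueBound.

Lemma entangled_code_le_cliques (R : realType) (X Y I : finType)
    (N : channel R X Y) (cl : X -> I) (q : nat) :
  (forall x x', cl x = cl x' -> exists y, 0 < N x y /\ 0 < N x' y) ->
  entangled_zero_error_code N q -> (q <= #|I|)%N.
Proof.
move=> clique [dA [dB [rho [A [B [[rho_psd tr_rho] povmA povmB err0]]]]]].
(* The columns of [L] are unnormalized pure states whose mixture is [rho]. *)
have [L rhoE] : exists L : 'M[R[i]%C]_(dA * dB), rho = L *m L^t*.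
  by have [K ->] := psd_factor rho_psd; exists (K^t*); rewrite trmxCK.
pose K m x := sval (cid (psd_factor ((povmA m).1 x))).
have AE m x : A m x = (K m x)^t* *m K m x by rewrite /K; case: cid.
pose J y m := sval (cid (psd_factor ((povmB y).1 m))).
have BE y m : B y m = (J y m)^t* *m J y m by rewrite /J; case: cid.
pose W m x := (K m x *t 1%:M) *m L.
(* The columns of [w m x] span the support of Bob's unnormalized state after Alice obtains [x] for
   message [m]. *)
pose w m x := second_factor (W m x).
(* The total error is a vanishing sum of nonnegative terms, so each term vanishes. *)
have Jw0 m m' x y : m != m' -> 0 < N x y -> J y m' *m w m x = 0.
  move=> mm' Nxy.
  have tr_ge0 x' y' : 0 <= (N x' y')%:C%C * \tr (rho *m (A m x' *t B y' m')).
    by rewrite rhoE AE BE tr_tens_gram mulr_ge0 ?mxtrace_adj_ge0 // ler0c prob_ge0.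
  have sum_ge0 x' : true -> 0 <= \sum_y' (N x' y')%:C%C * \tr (rho *m (A m x' *t B y' m')).
    by move=> _; apply: sumr_ge0.
  have e0 := @psumr_eq0P _ _ _ _ sum_ge0 (err0 m m' mm') x isT.
  have /eqP := @psumr_eq0P _ _ _ _ (fun y' _ => tr_ge0 x y') e0 y isT.
  rewrite mulf_eq0 => /orP[/eqP[N0]|/eqP]; first by rewrite N0 ltxx in Nxy.
  rewrite rhoE AE BE tr_tens_gram => /mxtrace_adj_eq0.
  rewrite tensmx_decl -mulmxA => /(congr1 (@second_factor _ _ _ _)).
  rewrite second_factor_tens => ->; apply/matrixP => i j.
  by rewrite !mxE.
have Bw0 m m' x y : m != m' -> 0 < N x y -> B y m' *m w m x = 0.
  by move=> mm' Nxy; rewrite BE -mulmxA (Jw0 _ _ _ _ mm') ?mulmx0.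
(* All other effects of the POVM kill [w m x], and the effects sum to the identity. *)
have Bw m x y : 0 < N x y -> B y m *m w m x = w m x.
  move=> Nxy; rewrite -[RHS]mul1mx -(povmB y).2 mulmx_suml (bigD1 m) //= big1.
    by rewrite addr0.
  by move=> m' ne; rewrite Bw0 // eq_sym.
(* For an output [y] common to [x] and [x'], the effect [B y m] fixes [w m x] and kills
   [w m' x']. *)
have w_orth m m' x x' : m != m' -> cl x = cl x' -> (w m x)^t* *m w m' x' = 0.
  move=> mm' /clique[y [Nxy Nx'y]]; rewrite -(Bw m x y) // adjmxM -mulmxA.
  have -> : (B y m)^t* = B y m by rewrite BE adjmxM trmxCK.
  by rewrite Bw0 ?mulmx0 // eq_sym.
(* Matrix subspaces are row spaces, hence the adjoints: [U m c] collects the supports left to Bob by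
   the outcomes in clique [c]. *)
pose U m c := (\sum_(x | cl x == c) <<(w m x)^t*>>)%MS.
have Uw0 m m' c x' : m != m' -> cl x' = c -> U m c *m w m' x' = 0.
  move=> mm' cx'; apply/sub_kermxP/sumsmx_subP => x /eqP cx.
  by rewrite genmxE; apply/sub_kermxP; rewrite w_orth // cx.
have U_orth m m' c : m != m' -> U m c *m (U m' c)^t* = 0.
  move=> mm'; rewrite -[LHS]trmxCK adjmxM trmxCK.
  suff -> : U m' c *m (U m c)^t* = 0 by rewrite trmx0 map_mx0.
  apply/sub_kermxP/sumsmx_subP => x' /eqP cx'.
  by rewrite genmxE; apply/sub_kermxP; rewrite -adjmxM Uw0 // trmx0 map_mx0.
pose P m c := sval (cid (orthogonal_projector (U m c))).
have PE m c : P m c = (P m c)^t* *m P m c by rewrite /P; case: cid => ? [].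
have UP m c : U m c *m P m c = U m c by rewrite /P; case: cid => ? [].
have P0 m c k (V : 'M[R[i]%C]_(k, dB)) : U m c *m V^t* = 0 -> P m c *m V^t* = 0.
  by rewrite /P; case: cid => ? [? ?]; apply.
have adjP m c : (P m c)^t* = P m c by rewrite PE adjmxM trmxCK.
have P_orth m m' c : m != m' -> P m c *m P m' c = 0.
  move=> mm'; rewrite -(adjP m' c); apply: (P0 m).
  rewrite -[LHS]trmxCK adjmxM trmxCK P0 ?trmx0 ?map_mx0 //.
  by rewrite U_orth // eq_sym.
have Pw m x : P m (cl x) *m w m x = w m x.
  have /submxP[D wE] : ((w m x)^t* <= U m (cl x))%MS.
    by rewrite -(genmxE (_^t*)) (sumsmx_sup x).
  rewrite -[RHS]trmxCK wE -(UP m (cl x)) mulmxA -wE.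
  by rewrite adjmxM trmxCK adjP.
have PW m x : (1%:M *t P m (cl x)) *m W m x = W m x.
  by apply: second_factor_inj; rewrite second_factor_tens Pw.
have trAE m x T : \tr (rho *m (A m x *t T)) =
    \tr (L^t* *m (((K m x)^t* *t 1%:M) *m ((1%:M *t T) *m W m x))).
  rewrite rhoE AE.
  have -> : ((K m x)^t* *m K m x) *t T =
      ((K m x)^t* *t 1%:M) *m ((1%:M *t T) *m (K m x *t 1%:M)).
    by rewrite !tensmx_mul !mul1mx mulmx1.
  exact: mxtrace_rotate.
(* The projector fixes Bob's state, so inserting it loses no probability. *)
have trAP m x : \tr (rho *m (A m x *t P m (cl x))) = \tr (rho *m (A m x *t 1%:M)).
  by rewrite !trAE PW tensmx11 mul1mx.
have tr_ge0 a b (Z : 'M[R[i]%C]_(a, dA)) (V : 'M[R[i]%C]_(b, dB)) :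
    0 <= \tr (rho *m ((Z^t* *m Z) *t (V^t* *m V))).
  by rewrite rhoE tr_tens_gram mxtrace_adj_ge0.
have adj1 n : (1%:M : 'M[R[i]%C]_n) = 1%:M^t* *m 1%:M.
  by rewrite mulmx1 trmx1 map_mx1.
(* Mutually orthogonal projectors add up to a projector [S]; then [1 - S] is a Gram matrix and has
   nonnegative weight in [rho]. *)
have sumP_le1 c : \tr (rho *m (1%:M *t \sum_m P m c)) <= 1.
  pose S := \sum_m P m c.
  have adjS : S^t* = S.
    rewrite /S raddf_sum map_mx_sum; apply: eq_bigr => m _; exact: adjP.
  have SS : S *m S = S.
    rewrite mulmx_suml; apply: eq_bigr => m _; rewrite mulmx_sumr (bigD1 m) //=.
    rewrite big1 ?addr0; first by rewrite -{1}adjP -PE.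
    by move=> m' ne; rewrite P_orth // eq_sym.
  have SE : 1%:M - S = (1%:M - S)^t* *m (1%:M - S).
    rewrite adjmxB adjS trmx1 map_mx1.
    by rewrite mulmxBl mul1mx mulmxBr mulmx1 SS subrr subr0.
  rewrite -subr_ge0; have := tr_ge0 _ _ 1%:M (1%:M - S).
  by rewrite -SE -adj1 tensmx_subr mulmxBr linearB /= tensmx11 mulmx1 tr_rho.
rewrite -(ler_nat R[i]%C).
(* Each message contributes total probability 1, split over Alice's outcomes with the clique
   projectors inserted. *)
have -> : q%:R = \sum_(m < q) \sum_x \tr (rho *m (A m x *t P m (cl x))).
  transitivity (\sum_(m < q) (1 : R[i]%C)); first by rewrite sumr_const card_ord.
  apply: eq_bigr => m _; under eq_bigr do rewrite trAP.
  by rewrite -linear_sum -mulmx_sumr -tensmx_suml (povmA m).2 tensmx11 mulmx1.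
have -> : #|I|%:R = \sum_(c : I) (1 : R[i]%C) by rewrite sumr_const.
apply: le_trans (ler_sum _ (fun c _ => sumP_le1 c)).
under [leRHS]eq_bigr do rewrite tensmx_sumr mulmx_sumr linear_sum.
rewrite [leRHS]exchange_big /=; apply: ler_sum => m _.
rewrite -[in leRHS](povmA m).2.
under [leRHS]eq_bigr do rewrite tensmx_suml mulmx_sumr linear_sum.
rewrite [leRHS]exchange_big /=; apply: ler_sum => x _.
(* Only the clique containing [x] is kept; the other terms are nonnegative. *)
rewrite [leRHS](bigD1 (cl x)) //= lerDl; apply: sumr_ge0 => c _.
by rewrite AE PE tr_ge0.
Qed.

(** * Entanglement-assisted codes from orthonormal frames *)

Section FrameCode.
Variables (R : realType) (X Y : finType) (N : channel R X Y).

Local Notation complexify := (map_mx (real_complex R)).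

Lemma complexify_adj m n (Z : 'M[R]_(m, n)) : (complexify Z)^t* = complexify Z^T.
Proof. by apply/matrixP => i j; rewrite !mxE; apply/eqP; rewrite eq_complex /= oppr0 !eqxx. Qed.

Lemma complexify_gram_psd m n (Z : 'M[R]_(m, n)) :
  positive_op (complexify (Z^T *m Z)).
Proof.
move=> v; rewrite map_mxM -complexify_adj -trace_mx11 !mulmxA -adjmxM -mulmxA.
exact: mxtrace_adj_ge0.
Qed.

Lemma projector_psd n (P : 'M[R]_n) :
  P^T = P -> P *m P = P -> positive_op (complexify P).
Proof. by move=> Pt PP; rewrite -PP -{1}Pt; apply: complexify_gram_psd. Qed.

Section OrthonormalFamily.
Variables (d : nat) (u : X -> 'cV[R]_d) (D : pred X).
Hypothesis u1 : forall x, (u x)^T *m u x = 1%:M.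
Hypothesis u_orth : forall x x', D x -> D x' -> x != x' -> (u x)^T *m u x' = 0.

Definition span_projector := \sum_(x | D x) u x *m (u x)^T.

Lemma span_projector_sym : span_projector^T = span_projector.
Proof.
by rewrite raddf_sum /=; apply: eq_bigr => x _; rewrite trmx_mul trmxK.
Qed.

Lemma span_projector_id x : D x -> (u x)^T *m span_projector = (u x)^T.
Proof.
move=> Dx; rewrite mulmx_sumr (bigD1 x) //= big1.
  by rewrite addr0 mulmxA u1 mul1mx.
by move=> x' /andP[Dx' ne]; rewrite mulmxA u_orth ?mul0mx // eq_sym.
Qed.

Lemma span_projector_proj : span_projector *m span_projector = span_projector.
Proof.
rewrite {1}/span_projector mulmx_suml; apply: eq_bigr => x Dx.
by rewrite -mulmxA span_projector_id.
Qed.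

End OrthonormalFamily.

(* Unnormalized: [\sum_i e_i (x) e_i]. *)
Definition maximally_entangled d : 'cV[R]_(d * d) :=
  \col_k ((mxtens_unindex k).1 == (mxtens_unindex k).2)%:R.

Lemma maximally_entangled_form d (A B : 'M[R]_d) :
  (maximally_entangled d)^T *m (A *t B) *m maximally_entangled d
  = (\tr (A *m B^T))%:M.
Proof.
apply/matrixP => i j; rewrite !ord1 {i j} -mulmxA mxE sum_mxtens mxE eqxx mulr1n.
apply: eq_bigr => i _; rewrite mxE (bigD1 i) //= big1 ?addr0; last first.
  by move=> i' /negPf ne; rewrite !mxE mxtens_indexK /= eq_sym ne mul0r.
rewrite !mxE mxtens_indexK eqxx mul1r sum_mxtens; apply: eq_bigr => j _.
rewrite (bigD1 j) //= big1 ?addr0; last first.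
  by move=> j' /negPf ne; rewrite !mxE !mxtens_indexK /= eq_sym ne mulr0.
by rewrite tensmxE !mxE mxtens_indexK eqxx mulr1.
Qed.

(* Alice measures in the frame of her message and sends the outcome; the
   vectors compatible with Bob's output are orthogonal, so he can measure which
   one occurred. *)
Lemma frames_entangled_code (d q : nat) (u : X -> 'cV[R]_d) (cl : X -> 'I_q) :
  (0 < d)%N -> (0 < q)%N ->
  (forall x, (u x)^T *m u x = 1%:M) ->
  (forall x x', confusable N x x' -> (u x)^T *m u x' = 0) ->
  (forall m, \sum_(x | cl x == m) u x *m (u x)^T = 1%:M) ->
  entangled_zero_error_code N q.
Proof.
move=> d_gt0 q_gt0 u1 u_conf frame.
pose rho := d%:R^-1 *: (maximally_entangled d *m (maximally_entangled d)^T).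
have tr_rho (A B : 'M[R]_d) : \tr (rho *m (A *t B)) = d%:R^-1 * \tr (A *m B^T).
  rewrite /rho -scalemxAl linearZ /= -mulmxA mxtrace_mulC.
  by rewrite maximally_entangled_form trace_mx11 mxE eqxx mulr1n.
pose S y m := span_projector u (fun x => (0 < N x y) && (cl x == m)).
pose T y := span_projector u (fun x => 0 < N x y).
(* The [S y m] sum only to [T y]. Assigning the remainder [1 - T y] to message 0 completes the POVM
   and causes no error, since it kills every vector compatible with [y]. *)
pose B y m := S y m + (if m == Ordinal q_gt0 then 1%:M - T y else 0).
pose A m x : 'M[R]_d := if cl x == m then u x *m (u x)^T else 0.
have u_orth y x x' : 0 < N x y -> 0 < N x' y -> x != x' -> (u x)^T *m u x' = 0.
  by move=> Nx Nx' /eqP ne; apply: u_conf; split=> //; exists y.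
have T_id y x : 0 < N x y -> (u x)^T *m T y = (u x)^T.
  by move=> Nx; apply: span_projector_id => // ? ?; apply: u_orth.
have uB y x m : 0 < N x y -> cl x != m -> (u x)^T *m B y m = 0.
  move=> Nx ne; rewrite /B mulmxDr [X in X + _](_ : _ = 0) ?add0r.
    by case: eqP => _; rewrite ?mulmx0 // mulmxBr T_id // mulmx1 subrr.
  rewrite mulmx_sumr big1 // => x' /andP[Nx' /eqP clx'].
  rewrite mulmxA (u_orth y) ?mul0mx //.
  by apply: contraNneq ne => ->; apply/eqP.
(* [tr_rho] transposes Bob's operator; symmetry removes the transpose. *)
have B_sym y m : (B y m)^T = B y m.
  rewrite /B linearD /= span_projector_sym; congr (_ + _).
  by case: eqP => _; rewrite ?trmx0 // linearB /= span_projector_sym trmx1.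
exists d, d, (complexify rho), (fun m x => complexify (A m x)),
  (fun y m => complexify (B y m)).
have psdD n (P Q : 'M[R[i]%C]_n) : positive_op P -> positive_op Q -> positive_op (P + Q).
  by move=> P_ge0 Q_ge0 v; rewrite mulmxDr mulmxDl mxE addr_ge0.
have psd0 n : positive_op (complexify (0 : 'M[R]_n)).
  by move=> v; rewrite map_mx0 mulmx0 mul0mx mxE.
split.
- split.
    have -> : rho = (Num.sqrt d%:R^-1 *: (maximally_entangled d)^T)^T *m
       (Num.sqrt d%:R^-1 *: (maximally_entangled d)^T).
      rewrite [(_ *: _)^T]linearZ /= trmxK -scalemxAl -scalemxAr scalerA -expr2.
      by rewrite sqr_sqrtr // invr_ge0 ler0n.
    exact: complexify_gram_psd.
  rewrite trace_map_mx -[rho]mulmx1 -tensmx11 tr_rho trmx1 mulmx1 mxtrace1.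
  by rewrite mulVf // pnatr_eq0 -lt0n.
- move=> m; split.
    move=> x; rewrite /A; case: eqP => _ //.
    by rewrite -{1}(trmxK (u x)); apply: complexify_gram_psd.
  rewrite -map_mx_sum -[1%:M](map_mx1 (real_complex R)); congr complexify.
  by rewrite -(frame m) [RHS]big_mkcond.
- move=> y; split.
    move=> m; rewrite /B map_mxD; apply: psdD.
      apply: projector_psd; first exact: span_projector_sym.
      apply: span_projector_proj => // x x' /andP[Nx _] /andP[Nx' _].
      exact: u_orth Nx Nx'.
    case: eqP => _ //; apply: projector_psd.
      by rewrite linearB /= span_projector_sym trmx1.
    rewrite mulmxBl mul1mx mulmxBr mulmx1 span_projector_proj ?subrr ?subr0 //.
    by move=> x x'; apply: u_orth.
  rewrite -map_mx_sum -[1%:M](map_mx1 (real_complex R)); congr complexify.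
  rewrite big_split /= -big_mkcond big_pred1_eq.
  have -> : \sum_m S y m = T y by rewrite /T /span_projector (partition_big cl predT).
  by rewrite addrC subrK.
- move=> m m' mm'; apply: big1 => x _; apply: big1 => y _.
  have := prob_ge0 N x y; rewrite le_eqVlt => /orP[/eqP <-|Nxy].
    by rewrite mul0r.
  rewrite -map_mxT -map_mxM trace_map_mx tr_rho /A B_sym.
  case: eqP => [clx|_]; last by rewrite mul0mx mxtrace0 mulr0 mulr0.
  by rewrite -mulmxA uB ?clx // mulmx0 mxtrace0 mulr0 mulr0.
Qed.

End FrameCode.

(** * Tensor powers of a family of vectors *)

Section TensorPowerFamily.
Variables (R : realType) (X : finType) (d n : nat) (u : X -> 'cV[R]_d).

Local Notation coord k := (enum_val k : {ffun 'I_n -> 'I_d}).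

(** The vector [u (x 0) (x) ... (x) u (x (n-1))]. Coordinates are enumerated functions, so that sums
    over them expand by distributivity of products over sums. *)
Definition tensor_power_vector (x : {ffun 'I_n -> X}) :
    'cV[R]_#|{ffun 'I_n -> 'I_d}| :=
  \col_k \prod_i u (x i) (coord k i) 0.

Lemma tensor_power_vector_dot x x' :
  (tensor_power_vector x)^T *m tensor_power_vector x'
  = (\prod_i ((u (x i))^T *m u (x' i)) 0 0)%:M.
Proof.
apply/matrixP => i j; rewrite !ord1 {i j} !mxE eqxx mulr1n.
under [RHS]eq_bigr do rewrite mxE.
rewrite bigA_distr_bigA /= (reindex_onto enum_rank enum_val) /=; last first.
  by move=> k _; rewrite enum_valK.
apply: eq_big => [f|f _]; first by rewrite enum_rankK eqxx.
by rewrite !mxE enum_rankK -big_split; apply: eq_bigr => i _; rewrite !mxE.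
Qed.

(** By distributivity, each entry of the sum is a product of entries of identity matrices, one per
    position. *)
Lemma tensor_power_vector_frame (I : finType) (cl : X -> I) (m : {ffun 'I_n -> I}) :
  (forall c, \sum_(x | cl x == c) u x *m (u x)^T = 1%:M) ->
  \sum_(x : {ffun 'I_n -> X} | [ffun i => cl (x i)] == m)
     tensor_power_vector x *m (tensor_power_vector x)^T = 1%:M.
Proof.
move=> frame; apply/matrixP => k l; rewrite summxE mxE.
transitivity (\sum_(x in family (fun i => [pred x | cl x == m i]))
    \prod_i (u (x i) *m (u (x i))^T) (coord k i) (coord l i)).
  apply: eq_big => [x|x _].
    apply/eqP/familyP => [<- i|clx]; first by rewrite inE ffunE.
    by apply/ffunP => i; rewrite ffunE; have /eqP := clx i.
  rewrite mxE big_ord1 !mxE -big_split; apply: eq_bigr => i _ /=.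
  by rewrite mxE big_ord1 !mxE.
rewrite -(bigA_distr_big_dep (fun i => [pred x | cl x == m i])
  (fun i x => (u x *m (u x)^T) (coord k i) (coord l i))) /=.
under eq_bigr do rewrite -summxE frame mxE.
have [->|ne] := eqVneq k l; first by apply: big1 => i _; rewrite eqxx.
have /existsP[i ne_i] : [exists i, coord k i != coord l i].
  apply: contra_neqT ne => /existsPn eq_kl; apply: enum_val_inj; apply/ffunP => i.
  by apply/eqP; rewrite -[_ == _]negbK.
by rewrite (bigD1 i) //= (negPf ne_i) mul0r.
Qed.

End TensorPowerFamily.

(** * Confusability in powers of a channel *)

Section PowerGraph.
Variables (R : realType) (X Y : finType) (N : channel R X Y) (n : nat).

Lemma power_prob_gt0 x y :
  (0 < channel_power N n x y) = [forall i, 0 < N (x i) (y i)].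
Proof.
rewrite lt_def prodr_ge0 ?andbT; last by move=> *; apply: prob_ge0.
apply/prodf_neq0/forallP => [N0 i|N_gt0 i _]; last by rewrite gt_eqF.
by rewrite lt_def N0 // prob_ge0.
Qed.

(** Sharing an output, unlike [confusable], is reflexive, and is therefore the relation that a
    strong power tests position by position. *)
Lemma power_share_output (x x' : {ffun 'I_n -> X}) :
  (forall i, exists y, 0 < N (x i) y /\ 0 < N (x' i) y) <->
  exists y, 0 < channel_power N n x y /\ 0 < channel_power N n x' y.
Proof.
split=> [share|[y []]]; last first.
  by rewrite !power_prob_gt0 => /forallP Nx /forallP Nx' i; exists (y i).
have /choice[y Ny] := share.
exists (finfun y); rewrite !power_prob_gt0.
by split; apply/forallP => i; rewrite ffunE; have [] := Ny i.
Qed.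

Lemma exists_output x : exists y, 0 < N x y.
Proof.
apply/not_existsP => N0; have := prob_sum1 N x; rewrite big1 => [/eqP|y _].
  by rewrite eq_sym oner_eq0.
by apply/eqP; rewrite eq_le prob_ge0 leNgt andbT; apply/negP/N0.
Qed.

End PowerGraph.

(** * Maxima of bounded sets of integers *)

Section Largest.
Variable A : set nat.

Lemma largest_le k : (forall q, A q -> (q <= k)%N) -> (largest A <= k)%N.
Proof.
by move=> A_le; rewrite /largest; case: xgetP => [q _ [/A_le]|].
Qed.

Lemma largest_in q k : A q -> (forall q, A q -> (q <= k)%N) -> A (largest A).
Proof.
move=> Aq A_le.
have exA : exists q', `[< A q' >] by exists q; apply/asboolP.
have A_leb q' : `[< A q' >] -> (q' <= k)%N by move/asboolP; apply: A_le.
case: (ex_maxnP exA A_leb) => m /asboolP Am m_max.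
rewrite /largest; case: xgetP => [? _ []//|/(_ m) []]; split=> // q' Aq'.
by rewrite leEnat; apply: m_max; apply/asboolP.
Qed.

Lemma le_largest q k : A q -> (forall q, A q -> (q <= k)%N) -> (q <= largest A)%N.
Proof.
move=> Aq A_le; have A_leb := largest_in Aq A_le.
have [//|lt_max] := leqP q (largest A).
move: A_leb lt_max; rewrite /largest; case: xgetP => [m _ [_ m_max] _|no_max _].
  by rewrite ltnNge -leEnat m_max.
have exA : exists q', `[< A q' >] by exists q; apply/asboolP.
have A_le' q' : `[< A q' >] -> (q' <= k)%N by move/asboolP; apply: A_le.
case: (ex_maxnP exA A_le') => m /asboolP Am m_max; case: (no_max m).
by split=> // q' Aq'; rewrite leEnat; apply: m_max; apply/asboolP.
Qed.

End Largest.

(** * Unassisted zero-error codes *)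

Section ZeroErrorCodes.
Variables (R : realType) (X Y : finType) (N : channel R X Y).

Lemma zero_error_codeP q (enc : 'I_q -> X) (dec : Y -> 'I_q) :
  (forall m, \sum_(y | dec y != m) N (enc m) y = 0) <->
  (forall m y, 0 < N (enc m) y -> dec y = m).
Proof.
split=> [err0 m y N_gt0|ok m]; last first.
  apply: big1 => y; apply: contraNeq => N_neq0.
  by apply/eqP/ok; rewrite lt_def N_neq0 prob_ge0.
apply/eqP; apply: contraTT N_gt0 => ne; rewrite -leNgt le_eqVlt.
by rewrite (@psumr_eq0P _ _ _ _ (fun y _ => prob_ge0 N (enc m) y) (err0 m) y ne) eqxx.
Qed.

(** The encoder is injective: each codeword has a possible output, which decodes to its message.
    This bound makes [M0] a genuine maximum. *)
Lemma zero_error_code_le q : zero_error_code N q -> (q <= #|X|)%N.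
Proof.
move=> [enc [dec /zero_error_codeP ok]].
rewrite -[q]card_ord; apply: (leq_card enc) => m m' eq_enc.
have [y Ny] := exists_output N (enc m).
by rewrite -(ok m y Ny) (ok m' y) // -eq_enc.
Qed.

Lemma M0_code (x : X) : zero_error_code N (M0 N).
Proof.
apply: (@largest_in _ 1 #|X|); last exact: zero_error_code_le.
by exists (fun=> x), (fun=> ord0) => m; rewrite big_pred0 // => y; rewrite (ord1 m).
Qed.

Lemma M0_ge q : zero_error_code N q -> (q <= M0 N)%N.
Proof. by move=> code; apply: (@le_largest _ q #|X|) => // *; apply: zero_error_code_le. Qed.

End ZeroErrorCodes.

(** * Product codes and Haemers' bound *)

Section PowerCodes.
Variables (R : realType) (X Y : finType) (N : channel R X Y).

Definition cat_ffun (T : Type) m n (x : 'I_m -> T) (y : 'I_n -> T) :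
    {ffun 'I_(m + n) -> T} :=
  [ffun i : 'I_(m + n) => match fintype.split i with inl j => x j | inr j => y j end].

(** Codewords are concatenated, and the two halves of the output are decoded separately;
    [mxtens_index] numbers the pairs of messages. *)
Lemma zero_error_code_power_add m n q r :
  zero_error_code (channel_power N m) q -> zero_error_code (channel_power N n) r ->
  zero_error_code (channel_power N (m + n)) (q * r).
Proof.
move=> [enc1 [dec1 /zero_error_codeP ok1]] [enc2 [dec2 /zero_error_codeP ok2]].
exists (fun k => cat_ffun (enc1 (mxtens_unindex k).1) (enc2 (mxtens_unindex k).2)).
exists (fun y : {ffun 'I_(m + n) -> Y} => mxtens_index (dec1 [ffun i => y (lshift n i)],
                               dec2 [ffun i => y (rshift m i)])).
apply/zero_error_codeP => k y; rewrite power_prob_gt0 => /forallP N_gt0.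
rewrite (ok1 (mxtens_unindex k).1) ?(ok2 (mxtens_unindex k).2).
- by rewrite mxtens_unindexK.
- rewrite power_prob_gt0; apply/forallP => i; have := N_gt0 (rshift m i).
  by rewrite !ffunE (unsplitK (inr i)).
- rewrite power_prob_gt0; apply/forallP => i; have := N_gt0 (lshift n i).
  by rewrite !ffunE (unsplitK (inl i)).
Qed.

Lemma M0_power_add (x : X) m n :
  (M0 (channel_power N m) * M0 (channel_power N n)
    <= M0 (channel_power N (m + n)))%N.
Proof.
by apply/M0_ge/zero_error_code_power_add; apply: (M0_code _ [ffun=> x]).
Qed.

Lemma M0_power_gt0 (x : X) n : (0 < M0 (channel_power N n))%N.
Proof.
apply: M0_ge; exists (fun=> [ffun=> x]), (fun=> ord0) => m.
by rewrite big_pred0 // => y; rewrite (ord1 m).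
Qed.

(* Haemers' bound: on the codewords, the [n]-th tensor power of the matrix
   [\sum_j f x j * g x' j] is diagonal and invertible. *)
Lemma M0_power_haemers (F : fieldType) (r n : nat) (f g : X -> 'I_r -> F) :
  (forall x, \sum_j f x j * g x j != 0) ->
  (forall x x', ~ (exists y, 0 < N x y /\ 0 < N x' y) ->
    \sum_j f x j * g x' j = 0) ->
  (M0 (channel_power N n) <= r ^ n)%N.
Proof.
move=> diag offdiag; apply: largest_le => q [enc [dec /zero_error_codeP ok]].
pose A := \matrix_(m < q, k < #|{ffun 'I_n -> 'I_r}|)
  \prod_i f (enc m i) ((enum_val k : {ffun 'I_n -> 'I_r}) i).
pose B := \matrix_(k < #|{ffun 'I_n -> 'I_r}|, m < q)
  \prod_i g (enc m i) ((enum_val k : {ffun 'I_n -> 'I_r}) i).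
have ABE m m' : (A *m B) m m' = \prod_i \sum_j f (enc m i) j * g (enc m' i) j.
  rewrite mxE bigA_distr_bigA /= [RHS](reindex_onto enum_val enum_rank) /=.
    apply: eq_big => [k|k _]; first by rewrite enum_valK eqxx.
    by rewrite !mxE -big_split.
  by move=> k _; rewrite enum_rankK.
have AB_diag : A *m B = diag_mx (\row_m (A *m B) m m).
  apply/matrixP => m m'; rewrite [RHS]mxE [(\row__ _) _ _]mxE.
  have [<-//|ne] := eqVneq m m'.
  rewrite /= mulr0n ABE.
  (* If every position had a common output, some output word would have to decode to both
     messages. *)
  have [i no_share] : exists i, ~ exists y, 0 < N (enc m i) y /\ 0 < N (enc m' i) y.
    apply/existsNP => share; have [y [Ny Ny']] := (power_share_output N _ _).1 share.
    by move/eqP: ne; apply; rewrite -(ok _ _ Ny) (ok _ _ Ny').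
  by rewrite (bigD1 i) //= offdiag // mul0r.
have AB_unit : A *m B \in unitmx.
  rewrite unitmxE AB_diag det_diag unitfE; apply/prodf_neq0 => m _.
  by rewrite mxE ABE; apply/prodf_neq0 => i _.
(* The invertible product has rank [q], at most the number [r ^ n] of columns of [A]. *)
rewrite -(mxrank_unit AB_unit) (leq_trans (mxrankM_maxl A B)) //.
by rewrite (leq_trans (rank_leq_col A)) // card_ffun !card_ord.
Qed.

End PowerCodes.

(** * Convergence for superadditive sequences *)

Lemma fekete_cvg (R : realType) (a : R^nat) (c : R) :
  (forall m n, a m + a n <= a (m + n)%N) -> (forall n, 0 <= a n) ->
  (forall n, a n <= n%:R * c) -> cvgn (fun n => n%:R^-1 * a n).
Proof.
move=> a_add a_ge0 a_le.
(* The limit will be the supremum of [a n / n]; the shift by one excludes [n = 0]. *)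
pose S := [set n.+1%:R^-1 * a n.+1 | n in [set: nat]].
have S_ub : ubound S c.
  by move=> _ [n _ <-]; rewrite mulrC ler_pdivrMr ?ltr0n // mulrC.
have S_sup : has_sup S by split; [exists (1%:R^-1 * a 1%N), 0%N|exists c].
have a_mul k n : n%:R * a k <= a (n * k)%N.
  elim: n => [|n IHn]; first by rewrite mul0r.
  rewrite mulSn; apply: le_trans (a_add _ _).
  by rewrite -natr1 mulrDl mul1r addrC lerD2l.
apply/cvg_ex; exists (sup S); apply/cvgrPdist_le => e e_gt0.
have e2_gt0 : 0 < e / 2 by rewrite divr_gt0.
have [_ [k _ <-] a_k] := sup_adherent e2_gt0 S_sup.
near=> n.
have n_gt0 : (0 < n)%N by near: n; exists 1%N.
have nR_gt0 : 0 < n%:R :> R by rewrite ltr0n.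
have n_le : n%:R^-1 * a n <= sup S.
  by apply: sup_upper_bound => //; exists n.-1; rewrite ?prednK.
rewrite ger0_norm ?subr_ge0 //.
have a_k1 : a k.+1 / n%:R <= e / 2.
  rewrite ler_pdivrMr // mulrC -ler_pdivrMr //.
  by near: n; exact: nbhs_infty_ger.
(* Divide [n] by [k.+1]: superadditivity bounds [a n] below by the quotient times [a k.+1], and the
   quotient exceeds [n / k.+1 - 1]. *)
have a_n : (n%:R / k.+1%:R - 1) * a k.+1 <= a n.
  apply: (@le_trans _ _ ((n %/ k.+1)%:R * a k.+1)).
    apply: ler_wpM2r => //; rewrite lerBlDr ler_pdivrMr ?ltr0n //.
    by rewrite natr1 -natrM ler_nat ltnW // ltn_ceil.
  apply: le_trans (a_mul _ _) _; rewrite {2}(divn_eq n k.+1).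
  by apply: le_trans (a_add _ _); rewrite lerDl.
have : k.+1%:R^-1 * a k.+1 - a k.+1 / n%:R <= n%:R^-1 * a n.
  rewrite [leRHS]mulrC ler_pdivlMr //; apply: le_trans a_n.
  rewrite le_eqVlt; apply/orP; left; apply/eqP; field.
  by rewrite nat1r pnatr_eq0 (gt_eqF nR_gt0).
have close (s x y z d : R) : s - d / 2 < x -> y <= d / 2 -> x - y <= z -> s - z <= d.
  by lra.
exact: close a_k a_k1.
Unshelve. all: by end_near.
Qed.

(** * The frames as integer lists, with checks by computation *)

Section E8Frames.

(* The 120 lines in 15 orthogonal frames of 8. For a < 7 frame [a] consists of
   the 2(e_j +- e_k) with j xor k = a + 1 (a 1-factorization of K_8); frame
   [7 + s] is the Hadamard matrix (-1)^(i . j) with the signs of coordinates 0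
   and [s] flipped (cosets of the extended Hamming code). All vectors have
   norm 8, so the roots e_i +- e_j appear doubled. *)
Definition e8_entry (a j i : nat) : int :=
  if (a < 7)%N then
    let k := Nat.lxor j a.+1 in
    if i == j then (if (j < k)%N then 2 else -2) else (i == k).*2%:Z
  else
    let s := (a - 7)%N in
    let flip := (s != 0%N) && ((i == 0%N) || (i == s)) in
    if flip (+) (odd i && odd j) (+) (odd i./2 && odd j./2)
       (+) (odd (i %/ 4) && odd (j %/ 4)) then -1 else 1.

Definition e8_row (t : nat * nat) : seq int := mkseq (e8_entry t.1 t.2) 8.

Definition seq_dot (v w : seq int) : int :=
  foldr (fun i d => nth 0 v i * nth 0 w i + d) 0 (iota 0 8).

Definition frame_indices : seq (nat * nat) :=
  [seq (a, j) | a <- iota 0 15, j <- iota 0 8].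

(* A symplectic basis of E_8 / 2 E_8: four mutually orthogonal copies of A_2. *)
Definition symplectic_roots : seq (nat * nat) :=
  [:: (0, 0); (1, 0); (0, 4); (1, 4); (3, 3); (7, 3); (3, 7); (7, 7)]%N.

(** Rows of norm 8 have 4 times the inner products of roots of norm 2, hence the division; the sign
    does not affect parity. *)
Definition root_parity (t : nat * nat) (k : nat) : bool :=
  odd (`|seq_dot (e8_row t) (e8_row (nth (0, 0)%N symplectic_roots k))|%N %/ 4).

(** Index 8 carries the constant 1. The others expand [<v, w>] mod 2 in the symplectic basis, where
    a coordinate of [v] is paired with the coordinate of [w] along the partner root; partners are
    [2i] and [2i + 1]. *)
Definition haemers_left t k := (k == 8) || root_parity t k.
Definition haemers_right t k :=
  (k == 8) || root_parity t (if odd k then k.-1 else k.+1).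

Definition e8_data (t : nat * nat) : (nat * nat) * seq int * (bitseq * bitseq) :=
  (t, e8_row t, (mkseq (haemers_left t) 9, mkseq (haemers_right t) 9)).

Definition seq_bit_dot (v w : bitseq) : nat :=
  foldr (fun k s => (nth false v k && nth false w k) + s)%N 0%N (iota 0 9).

Definition e8_pair_check (x y : (nat * nat) * seq int * (bitseq * bitseq)) : bool :=
  let: (t, v, (l, _)) := x in let: (t', w, (_, r)) := y in
  let d := seq_dot v w in
  (if t == t' then d == 8
   else if t.1 == t'.1 then d == 0 else [|| d == 0, d == 4 | d == -4])
  && ((d == 0) || (odd (seq_bit_dot l r) == (d == 8))).

(** The beta-redex makes [vm_compute] evaluate the table of 120 entries once and share it among all
    pairs. *)
Lemma e8_pairs_check :
  (fun s => all (fun x => all (e8_pair_check x) s) s) (map e8_data frame_indices).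
Proof. by vm_compute. Qed.

Definition two_root (i j : nat) (c : int) : seq int :=
  mkseq (fun l => if l == i then 2 else if l == j then c else 0) 8.

Definition two_roots : seq (seq int) :=
  flatten [seq [seq two_root i j c | c <- [:: 2; -2]] | i <- iota 0 8, j <- iota i.+1 (7 - i)].

Fixpoint sign_seqs (n : nat) : seq (seq int) :=
  if n is n'.+1 then [seq c :: s | c <- [:: 1; -1], s <- sign_seqs n'] else [:: [::]].

Definition even_sign_seqs :=
  [seq s <- sign_seqs 8 | foldr (fun i p => nth 0 s i * p) 1 (iota 0 8) == 1].

Definition seq_opp (v : seq int) := [seq - x | x <- v].

(** With [e8_vectors_check], this gives both inclusions between the frame lines and the lines of the
    root system; opposite vectors span the same line. *)
Lemma e8_row_check : all (fun t => [|| e8_row t \in two_roots,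
  seq_opp (e8_row t) \in two_roots | e8_row t \in even_sign_seqs]) frame_indices.
Proof. by vm_compute. Qed.

Lemma e8_vectors_check :
  (fun rows => all (fun v => (v \in rows) || (seq_opp v \in rows))
    (two_roots ++ even_sign_seqs)) (map e8_row frame_indices).
Proof. by vm_compute. Qed.

End E8Frames.

(** * From integer lists to lines of real vectors *)

Section E8Lines.
Variable R : realType.

Notation frame_vertex := ('I_15 * 'I_8)%type.

Definition vertex_index (t : frame_vertex) : nat * nat := (val t.1, val t.2).

Lemma vertex_index_inj : injective vertex_index.
Proof. by move=> [a j] [a' j'] [/val_inj -> /val_inj ->]. Qed.

Lemma mem_frame_indices t : t \in frame_indices -> exists t', vertex_index t' = t.
Proof.
move=> /allpairsP[[a j] []]; rewrite !mem_iota /= => a_lt j_lt ->.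
by exists (Ordinal a_lt, Ordinal j_lt).
Qed.

Lemma vertex_index_mem t : vertex_index t \in frame_indices.
Proof. by apply/allpairsP; exists (vertex_index t); rewrite !mem_iota /= !ltn_ord. Qed.

Definition vertex_dot (t t' : frame_vertex) : int :=
  seq_dot (e8_row (vertex_index t)) (e8_row (vertex_index t')).

Lemma vertex_pair_check t t' :
  e8_pair_check (e8_data (vertex_index t)) (e8_data (vertex_index t')).
Proof.
have /allP/(_ (e8_data (vertex_index t))) := e8_pairs_check.
move=> /(_ (map_f _ (vertex_index_mem t)))/allP; apply.
exact/map_f/vertex_index_mem.
Qed.

Lemma vertex_dotE t t' :
  if t == t' then vertex_dot t t' == 8
  else if t.1 == t'.1 then vertex_dot t t' == 0
  else [|| vertex_dot t t' == 0, vertex_dot t t' == 4 | vertex_dot t t' == -4].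
Proof.
have /andP[] := vertex_pair_check t t'.
by rewrite (inj_eq vertex_index_inj).
Qed.

Definition haemers_entry (t t' : frame_vertex) : bool :=
  odd (seq_bit_dot (mkseq (haemers_left (vertex_index t)) 9)
                   (mkseq (haemers_right (vertex_index t')) 9)).

Lemma vertex_dot_self t : vertex_dot t t = 8.
Proof. by have := vertex_dotE t t; rewrite eqxx => /eqP. Qed.

Lemma vertex_dot_frame t t' : t != t' -> t.1 = t'.1 -> vertex_dot t t' = 0.
Proof.
by move=> /negPf ne eq_frame; have := vertex_dotE t t'; rewrite ne eq_frame eqxx => /eqP.
Qed.

Lemma vertex_dot_neq t t' : t != t' ->
  [\/ vertex_dot t t' = 0, vertex_dot t t' = 4 | vertex_dot t t' = -4].
Proof.
move=> /negPf ne; have := vertex_dotE t t'; rewrite ne.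
case: ifP => _; first by move=> /eqP ->; constructor.
by case/or3P => /eqP ->; [constructor 1|constructor 2|constructor 3].
Qed.

Lemma haemers_entryE t t' : (vertex_dot t t' == 0) ||
  (haemers_entry t t' == (vertex_dot t t' == 8)).
Proof. by have /andP[] := vertex_pair_check t t'. Qed.

Lemma haemers_entry_self t : haemers_entry t t.
Proof. by have := haemers_entryE t t; rewrite vertex_dot_self => /eqP ->. Qed.

Lemma haemers_entry_neq t t' : t != t' -> vertex_dot t t' != 0 ->
  haemers_entry t t' = false.
Proof.
move=> ne /negPf dot0; have := haemers_entryE t t'; rewrite dot0 => /eqP ->.
by case: (vertex_dot_neq ne) dot0 => ->.
Qed.

Definition real_vector (v : seq int) : 'rV[R]_8 := \row_i (nth 0 v i)%:~R.

Definition vertex_vector t := real_vector (e8_row (vertex_index t)).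

Lemma real_vector_dot v w :
  real_vector v *m (real_vector w)^T = ((seq_dot v w)%:~R)%:M.
Proof.
apply/matrixP => i j; rewrite !ord1 {i j} !mxE eqxx mulr1n /seq_dot.
have -> : foldr (fun i d => nth 0 v i * nth 0 w i + d) 0 (iota 0 8) =
          \sum_(i < 8) nth 0 v i * nth 0 w i.
  by rewrite -(big_mkord xpredT (fun i => nth 0 v i * nth 0 w i)) /index_iota unlock.
by rewrite rmorph_sum; apply: eq_bigr => i _; rewrite !mxE rmorphM.
Qed.

Lemma real_vector_opp v : size v = 8%N -> real_vector (seq_opp v) = - real_vector v.
Proof.
move=> v8; apply/rowP => i; rewrite !mxE (nth_map 0) ?v8 ?ltn_ord //.
by rewrite rmorphN.
Qed.

Lemma two_rootsP v : reflect (exists i j : 'I_8, (i < j)%N /\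
    (v = two_root i j 2 \/ v = two_root i j (-2))) (v \in two_roots).
Proof.
apply: (iffP idP) => [/flattenP[vs /allpairsPdep[i [j []]]]|[i [j [ij]]]].
  rewrite !mem_iota /= => i_lt /andP[ij j_lt] ->.
  have j_lt8 : (j < 8)%N by rewrite (leq_trans j_lt) // ?addSn subnKC.
  rewrite !inE => v_in; exists (Ordinal i_lt), (Ordinal j_lt8); split=> //.
  by case/orP: v_in => /eqP ->; [left|right].
move=> v_eq; apply/flattenP; exists [seq two_root i j c | c <- [:: 2; -2]].
  apply/allpairsPdep; exists (i : nat), (j : nat); split=> //.
    by rewrite mem_iota /= ltn_ord.
  by rewrite mem_iota ij addSn subnKC ?ltn_ord // -ltnS ltn_ord.
by case: v_eq => ->; rewrite !inE eqxx ?orbT.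
Qed.

Lemma real_vector_two_root (i j : 'I_8) (c : int) : (i < j)%N ->
  real_vector (two_root i j (2 * c)) = 2 *: (basis_vector R i + c%:~R *: basis_vector R j).
Proof.
move=> ij; apply/rowP => l; rewrite !mxE nth_mkseq ?ltn_ord // eqxx /=.
rewrite -!val_eqE /=; case: (eqVneq (val l) (val i)) => [->|_].
  by rewrite (ltn_eqF ij) mulr0 addr0 mulr1.
by rewrite add0r; case: eqP => _; rewrite ?mulr0 ?mulr1 // rmorphM.
Qed.

Lemma mem_sign_seqs n s : (s \in sign_seqs n) =
  (size s == n) && all (fun c => (c == 1) || (c == -1)) s.
Proof.
elim: n s => [|n IHn] s; first by case: s.
apply/allpairsP/idP => [[[c s'] [/= c_in s'_in ->]]|].
  by move: c_in s'_in; rewrite IHn !inE /= eqSS => -> /andP[-> ->].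
case: s => [//|c s] /= /andP[s_n /andP[c1 s1]]; exists (c, s).
by rewrite IHn !inE c1 s1 -eqSS s_n.
Qed.

Lemma real_vector_scale_line c (v : 'rV[R]_8) : c != 0 -> <[c *: v]>%VS = <[v]>%VS.
Proof.
move=> c0; apply/eqP; rewrite eqEsubv -!memvE memvZ ?memv_line //=.
by rewrite -[X in X \in _](scalerK c0) memvZ ?memv_line.
Qed.

Lemma even_sign_seqsP s : s \in even_sign_seqs -> E8_vectors R (real_vector s).
Proof.
rewrite mem_filter mem_sign_seqs => /andP[/eqP s_prod /andP[/eqP s8 /allP s1]].
right; split=> [i|].
  have : nth 0 s i \in s by rewrite mem_nth ?s8.
  by move=> /s1/orP[]/eqP si; rewrite mxE si; [left|right; rewrite rmorphN1].
under eq_bigr do rewrite mxE.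
rewrite -rmorph_prod /= -[1]/(1%:~R) -{3}s_prod; congr _%:~R.
by rewrite -(big_mkord xpredT (fun i => nth 0 s i)) /index_iota unlock.
Qed.

Lemma E8_sign_vector (v : 'rV[R]_8) : (forall i, v 0 i = 1 \/ v 0 i = -1) ->
  \prod_i v 0 i = 1 -> exists2 s, s \in even_sign_seqs & real_vector s = v.
Proof.
move=> v1 v_prod; pose s : seq int := mkseq (fun i => if v 0 (inord i) == 1 then 1 else -1) 8.
have sE (i : 'I_8) : (nth 0 s i)%:~R = v 0 i.
  rewrite nth_mkseq // inord_val; case: eqP => [->//|]; by case: (v1 i) => ->.
exists s; last by apply/rowP => i; rewrite mxE sE.
rewrite mem_filter mem_sign_seqs size_mkseq eqxx; apply/andP; split; last first.
  by apply/allP => _ /mapP[i _ ->]; case: ifP; rewrite ?eqxx ?orbT.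
rewrite -(eqr_int R) [eqbRHS](_ : _ = \prod_i v 0 i); last by rewrite v_prod.
apply/eqP.
under [RHS]eq_bigr do rewrite -sE.
rewrite -rmorph_prod /=; congr _%:~R.
by rewrite -(big_mkord xpredT (fun i => nth 0 s i)) /index_iota unlock.
Qed.

Lemma vertex_line_in t : E8_lines R <[vertex_vector t]>%VS.
Proof.
have two0 : (2 : R) != 0 by rewrite pnatr_eq0.
have two_line v : v \in two_roots -> E8_lines R <[real_vector v]>%VS.
  move=> /two_rootsP[i [j [ij v_eq]]].
  have [c [c_eq v_c]] : exists c : int, (c = 1 \/ c = -1) /\ v = two_root i j (2 * c).
    by case: v_eq => ->; [exists 1|exists (-1)]; split; auto.
  rewrite v_c real_vector_two_root // real_vector_scale_line //.
  eexists; last by [].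
  left; exists i, j; split=> //; case: c_eq => ->; [left|right].
    by rewrite scale1r.
  by rewrite rmorphN1 scaleN1r.
have size_row : size (e8_row (vertex_index t)) = 8%N by rewrite size_mkseq.
have /or3P[] := allP e8_row_check _ (vertex_index_mem t).
- exact: two_line.
- move=> /two_line; rewrite real_vector_opp // -scaleN1r.
  by rewrite real_vector_scale_line // oppr_eq0 oner_eq0.
- by move=> /even_sign_seqsP s_in; exists (vertex_vector t).
Qed.

Lemma E8_lines_vertex L : E8_lines R L -> exists t, L = <[vertex_vector t]>%VS.
Proof.
have two0 : (2 : R) != 0 by rewrite pnatr_eq0.
have listed s : size s = 8%N -> s \in two_roots ++ even_sign_seqs ->
    exists t, <[real_vector s]>%VS = <[vertex_vector t]>%VS.
  move=> s8 /(allP e8_vectors_check)/orP[] /mapP[_ /mem_frame_indices[t <-] sE].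
    by exists t; rewrite sE.
  exists t; rewrite /vertex_vector -sE real_vector_opp // -scaleN1r.
  by rewrite real_vector_scale_line // oppr_eq0 oner_eq0.
have two_line (i j : 'I_8) (c : int) : (i < j)%N -> c = 1 \/ c = -1 ->
    exists t, <[basis_vector R i + c%:~R *: basis_vector R j]>%VS = <[vertex_vector t]>%VS.
  move=> ij c1; have [] := listed (two_root i j (2 * c)).
  - by rewrite size_mkseq.
  - rewrite mem_cat; apply/orP; left; apply/two_rootsP; exists i, j; split=> //.
    by case: c1 => ->; [left|right].
  - move=> t; rewrite real_vector_two_root // real_vector_scale_line // => tE.
    by exists t.
move=> [v [[i [j [ij [->|->]]]]|[v1 v_prod]] <-].
- by have := two_line i j 1 ij (or_introl erefl); rewrite scale1r.
- by have := two_line i j (-1) ij (or_intror erefl); rewrite rmorphN1 scaleN1r.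
- have [s s_in <-] := E8_sign_vector v1 v_prod; apply: listed.
    by move: s_in; rewrite mem_filter mem_sign_seqs => /and3P[_ /eqP].
  by rewrite mem_cat s_in orbT.
Qed.

Lemma vertex_vector_dot t t' :
  vertex_vector t *m (vertex_vector t')^T = ((vertex_dot t t')%:~R)%:M.
Proof. exact: real_vector_dot. Qed.

(** Proportional vectors of norm 8 have inner product 8 or -8, whereas different vertices give 0, 4
    or -4. *)
Lemma vertex_line_inj t t' :
  <[vertex_vector t]>%VS = <[vertex_vector t']>%VS -> t = t'.
Proof.
move=> eq_line; apply/eqP; apply: contraT => ne.
have /vlineP[c tE] : vertex_vector t \in <[vertex_vector t']>%VS.
  by rewrite -eq_line memv_line.
have scal00 (a b : R) : (a%:M : 'M[R]_1) = b%:M -> a = b.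
  by move=> /matrixP/(_ 0 0); rewrite !mxE eqxx !mulr1n.
have := vertex_vector_dot t t'; rewrite {1}tE -scalemxAl vertex_vector_dot.
rewrite vertex_dot_self -mul_scalar_mx -scalar_mxM => /scal00 c8.
have := vertex_vector_dot t t; rewrite {2}tE linearZ /= -scalemxAr vertex_vector_dot.
rewrite vertex_dot_self -mul_scalar_mx -scalar_mxM => /scal00.
by case: (vertex_dot_neq ne) => dE; rewrite dE in c8 *; move: c8; nra.
Qed.

Lemma orthogonal_linesP t t' :
  orthogonal_lines <[vertex_vector t]>%VS <[vertex_vector t']>%VS <->
  vertex_dot t t' = 0.
Proof.
split=> [orth|dot0 _ _ /vlineP[c ->] /vlineP[c' ->]].
  have := orth _ _ (memv_line _) (memv_line _); rewrite vertex_vector_dot.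
  move=> /matrixP/(_ 0 0); rewrite !mxE eqxx mulr1n => /eqP.
  by rewrite intr_eq0 => /eqP.
rewrite linearZ /= -scalemxAr -scalemxAl vertex_vector_dot dot0.
by rewrite raddf0 !scaler0.
Qed.

(** The rows of [G] are orthogonal of norm 8, so [G^T] is a right inverse of [8^-1 *: G]; for square
    matrices it is also a left inverse, which is the claim. *)
Lemma vertex_frame a :
  \sum_j (vertex_vector (a, j))^T *m vertex_vector (a, j) = 8%:M.
Proof.
pose G : 'M[R]_8 := \matrix_j vertex_vector (a, j).
have GG : (8^-1 *: G) *m G^T = 1%:M.
  apply/row_matrixP => i; apply/rowP => j.
  rewrite -scalemxAl !mxE.
  have -> : \sum_k G i k * G^T k j = (vertex_vector (a, i) *m (vertex_vector (a, j))^T) 0 0.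
    by rewrite [RHS]mxE; apply: eq_bigr => k _; rewrite !mxE.
  rewrite vertex_vector_dot mxE eqxx mulr1n.
  have [<-|ne] := eqVneq i j; first by rewrite vertex_dot_self mulVf // pnatr_eq0.
  by rewrite vertex_dot_frame ?mulr0 // xpair_eqE eqxx.
have := mulmx1C GG; rewrite -scalemxAr => /(congr1 (fun M => 8 *: M)).
rewrite scalerA divff ?pnatr_eq0 // scale1r scalemx1 => <-.
apply/matrixP => k l; rewrite summxE mxE; apply: eq_bigr => j _.
by rewrite !mxE big_ord1 !mxE.
Qed.

End E8Lines.

(** * Message counts for a channel with the E8 orthogonality graph *)

Section E8Channel.
Variables (R : realType) (X Y : finType) (N : channel R X Y).
Hypothesis hN : has_confusability_graph N (E8_lines R) (@orthogonal_lines R).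

(** Transports the graph isomorphism to pairs of a frame and a position in it, where adjacency is an
    integer test. *)
Lemma E8_channel_vertices : exists2 g : X -> 'I_15 * 'I_8, bijective g &
  forall x x', confusable N x x' <-> vertex_dot (g x) (g x') = 0.
Proof.
have [f [f_fun f_inj f_surj] f_conf] := hN.
have line x : exists t, f x = <[vertex_vector R t]>%VS.
  by apply: E8_lines_vertex; apply: f_fun.
have [g fE] := choice line.
have g_inj : injective g.
  by move=> x x' eq_g; apply: f_inj; rewrite ?inE // !fE eq_g.
exists g; last by move=> x x'; rewrite f_conf !fE; apply: orthogonal_linesP.
have /choice[h gh] t : exists x, g x = t.
  have [x _ fx] := f_surj _ (vertex_line_in R t).
  by exists x; apply: (@vertex_line_inj R); rewrite -fE.
by exists h => // x; apply: g_inj.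
Qed.

Section Vertices.
Variable g : X -> 'I_15 * 'I_8.
Hypothesis g_bij : bijective g.
Hypothesis g_conf : forall x x', confusable N x x' <-> vertex_dot (g x) (g x') = 0.

Lemma frame_shares_output x x' : (g x).1 = (g x').1 ->
  exists y, 0 < N x y /\ 0 < N x' y.
Proof.
move=> eq_frame; have [->|ne] := eqVneq x x'.
  by have [y Ny] := exists_output N x'; exists y.
have /g_conf[] // : vertex_dot (g x) (g x') = 0.
by rewrite vertex_dot_frame // (inj_eq (bij_inj g_bij)).
Qed.

Lemma E8_M0_le n : (M0 (channel_power N n) <= 9 ^ n)%N.
Proof.
pose f x (j : 'I_9) : 'F_2 := (haemers_left (vertex_index (g x)) j)%:R.
pose f' x (j : 'I_9) : 'F_2 := (haemers_right (vertex_index (g x)) j)%:R.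
have sumE x x' : \sum_j f x j * f' x' j =
    (haemers_entry (g x) (g x'))%:R.
  rewrite /haemers_entry; set v := mkseq _ _; set w := mkseq _ _.
  have -> : seq_bit_dot v w = (\sum_(k < 9) (nth false v k && nth false w k))%N.
    by rewrite -(big_mkord xpredT (fun k => nth false v k && nth false w k : nat)) /index_iota unlock.
  (* In ['F_2] a natural number equals its parity, so the Boolean check computes the matrix
     entry. *)
  have F2_odd k : (odd k)%:R = k%:R :> 'F_2.
    by rewrite -modn2; apply/val_inj; rewrite /= !val_Fp_nat // modn_mod.
  rewrite F2_odd natr_sum; apply: eq_bigr => k _.
  by rewrite !nth_mkseq // -mulnb natrM.
apply: (@M0_power_haemers _ _ _ N _ 9 n f f').
  by move=> x; rewrite sumE haemers_entry_self oner_eq0.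
move=> x x' no_share; have ne : x != x'.
  apply: contra_notN no_share => /eqP ->.
  by have [y Ny] := exists_output N x'; exists y.
have dot_neq0 : vertex_dot (g x) (g x') != 0.
  by apply: contra_notN no_share => /eqP/g_conf[].
by rewrite sumE haemers_entry_neq // (inj_eq (bij_inj g_bij)).
Qed.

Definition unit_vertex_vector x : 'cV[R]_8 :=
  (Num.sqrt 8)^-1 *: (vertex_vector R (g x))^T.

Lemma sqr_inv_sqrt8 : (Num.sqrt 8)^-1 * (Num.sqrt 8)^-1 = 8^-1 :> R.
Proof. by rewrite -invfM -expr2 sqr_sqrtr // ler0n. Qed.

Lemma unit_vertex_vector_dot x x' :
  (unit_vertex_vector x)^T *m unit_vertex_vector x' =
  (8^-1 * (vertex_dot (g x) (g x'))%:~R)%:M.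
Proof.
rewrite /unit_vertex_vector [(_ *: _)^T]linearZ /= trmxK -scalemxAl -scalemxAr.
by rewrite scalerA sqr_inv_sqrt8 vertex_vector_dot scale_scalar_mx.
Qed.

Lemma unit_vertex_vector_frame a :
  \sum_(x | (g x).1 == a) unit_vertex_vector x *m (unit_vertex_vector x)^T = 1%:M.
Proof.
have [h gK hK] := g_bij.
rewrite (reindex h) /=; last by exists g => ? _; [apply: hK|apply: gK].
transitivity (\sum_(t | (t.1 == a) && true)
    8^-1 *: ((vertex_vector R (t.1, t.2))^T *m vertex_vector R (t.1, t.2))).
  apply: eq_big => [t|t _]; first by rewrite hK andbT.
  rewrite /unit_vertex_vector hK [(_ *: _)^T]linearZ /= trmxK -scalemxAl -scalemxAr.
  by rewrite scalerA sqr_inv_sqrt8 -surjective_pairing.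
rewrite -(pair_big (fun i => i == a) xpredT (fun i j =>
  8^-1 *: ((vertex_vector R (i, j))^T *m vertex_vector R (i, j)))) /=.
by rewrite big_pred1_eq -scaler_sumr vertex_frame scale_scalar_mx mulVf //.
Qed.

Lemma E8_power_code n :
  entangled_zero_error_code (channel_power N n) #|{ffun 'I_n -> 'I_15}|.
Proof.
(* A message is a word of [n] frames, numbered by [enum_rank]. *)
pose cl (x : {ffun 'I_n -> X}) := enum_rank [ffun i => (g (x i)).1].
apply: (@frames_entangled_code _ _ _ _ #|{ffun 'I_n -> 'I_8}| _
  (tensor_power_vector unit_vertex_vector) cl).
- by rewrite card_ffun !card_ord expn_gt0.
- by rewrite card_ffun !card_ord expn_gt0.
- move=> x; rewrite tensor_power_vector_dot big1 // => i _.
  rewrite unit_vertex_vector_dot mxE eqxx mulr1n.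
  by rewrite vertex_dot_self mulVf // pnatr_eq0.
- move=> x x' [ne /power_share_output share].
  (* At a position where the words differ, the letters are confusable, hence orthogonal; this zero
     factor kills the inner product. *)
  have [i ne_i] : exists i, x i <> x' i.
    by apply/existsNP => eq_x; apply: ne; apply/ffunP.
  rewrite tensor_power_vector_dot (bigD1 i) //= unit_vertex_vector_dot.
  have /g_conf -> : confusable N (x i) (x' i) by split.
  by rewrite mulr0 mxE eqxx mul0r raddf0.
- move=> m; rewrite -[RHS](tensor_power_vector_frame (enum_val m) unit_vertex_vector_frame).
  by apply: eq_bigl => x; exact: (can2_eq enum_rankK enum_valK).
Qed.

(** Words with the same frame at each position form a clique of the strong power; these [15 ^ n]
    cliques give the upper bound, and [E8_power_code] attains it. *)
Lemma E8_M0E n : M0E (channel_power N n) = (15 ^ n)%N.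
Proof.
have card_frames : #|{ffun 'I_n -> 'I_15}| = (15 ^ n)%N.
  by rewrite card_ffun !card_ord.
have code_le q : entangled_zero_error_code (channel_power N n) q -> (q <= 15 ^ n)%N.
  move=> code; rewrite -card_frames.
  apply: (entangled_code_le_cliques (cl := fun x : {ffun 'I_n -> X} => [ffun i => (g (x i)).1]) _ code).
  move=> x x' /ffunP eq_frame; apply/power_share_output => i.
  by apply: frame_shares_output; have := eq_frame i; rewrite !ffunE.
apply/eqP; rewrite eqn_leq; apply/andP; split; first exact: largest_le.
by rewrite -card_frames; apply: le_largest (E8_power_code n) code_le.
Qed.

End Vertices.

End E8Channel.

(** * Logarithms to a base above 1 *)

Section Logarithm.
Variables (R : realType) (b : R).
Hypothesis b_gt1 : 1 < b.

Lemma log_le (x y : R) : 0 < x -> x <= y -> log b x <= log b y.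
Proof.
move=> x_gt0 xy; rewrite /log ler_pM2r ?invr_gt0 ?ln_gt0 //.
by rewrite ler_ln // posrE // (lt_le_trans x_gt0).
Qed.

Lemma log_ge0 (x : R) : 1 <= x -> 0 <= log b x.
Proof. by move=> x1; rewrite divr_ge0 ?ln_ge0 // ltW. Qed.

Lemma logM (x y : R) : 0 < x -> 0 < y -> log b (x * y) = log b x + log b y.
Proof. by move=> x0 y0; rewrite /log lnM ?posrE // mulrDl. Qed.

Lemma logX (x : R) n : 0 < x -> log b (x ^+ n) = n%:R * log b x.
Proof. by move=> x0; rewrite /log lnXn // mulr_natl mulrnAl. Qed.

End Logarithm.

(** * Limits of the two rates *)

Theorem mainTheorem4 (R : realType) (b : R) (hb : 1 < b)
    (X Y : finType) (N : channel R X Y)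
    (hN : has_confusability_graph N (E8_lines R) (@orthogonal_lines R)) :
  [/\ cvgn (C0_rate b N), C0 b N <= log b 9,
      cvgn (C0E_rate b N) & C0E b N = log b 15].
Proof.
have [g g_bij g_conf] := E8_channel_vertices hN.
(* An input letter guarantees [M0 >= 1], so that its logarithm is nonnegative and monotonicity
   applies. *)
have [x0 _] : exists x, g x = (ord0, ord0).
  by have [h _ hK] := g_bij; exists (h (ord0, ord0)).
have M0_gt0 n : 0 < (M0 (channel_power N n))%:R :> R.
  by rewrite ltr0n (M0_power_gt0 _ x0).
have log_le9 n : log b (M0 (channel_power N n))%:R <= n%:R * log b 9.
  by rewrite -logX // log_le // -natrX ler_nat (E8_M0_le g_bij g_conf).
have C0_cvg : cvgn (C0_rate b N).
  (* Superadditivity comes from concatenating codes, the linear bound from Haemers' bound. *)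
  apply: (@fekete_cvg _ (fun n => log b (M0 (channel_power N n))%:R) (log b 9)) => //.
    move=> m n; rewrite -logM // log_le ?mulr_gt0 // -natrM ler_nat.
    exact: (M0_power_add _ x0).
  by move=> n; rewrite log_ge0 // ler1n (M0_power_gt0 _ x0).
have C0E_lim : C0E_rate b N @ \oo --> log b 15.
  (* The rate equals [log b 15] only from [n = 1] on; at [n = 0] the convention [0^-1 = 0] makes it
     0. *)
  apply: cvg_near_cst; near=> n.
  have n_gt0 : (0 < n)%N by near: n; exists 1%N.
  rewrite /C0E_rate (E8_M0E g_bij g_conf) natrX logX // mulrA mulVf ?mul1r //.
  by rewrite pnatr_eq0 -lt0n.
split=> //; last exact: cvg_lim C0E_lim.
- apply: limr_le => //; near=> n.
  have n_gt0 : (0 < n)%N by near: n; exists 1%N.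
  by rewrite /C0_rate mulrC ler_pdivrMr ?ltr0n // mulrC.
- by apply/cvg_ex; exists (log b 15).
Unshelve. all: by end_near.
Qed.
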